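(* Let $\mathcal{C}$ be a codifferential category with finite coproducts, and suppose $\mathcal{C}$ has reflexive coequalizers and that these are preserved by $\otimes$ in each variable. Then every $T$-algebra $(A,\nu)$ has a universal $T$-derivation; that is, there exist an $A$-module $\Omega^T_A$ and a $T$-derivation $d_A:A\to\Omega^T_A$ such that for every $A$-module $M$ and every $T$-derivation $\partial:A\to M$ there is a unique $A$-linear map $\hat\partial:\Omega^T_A\to M$ with $d_A;\hat\partial=\partial$.
   Context: Composition is written in diagrammatic order: $f;g$ means first $f$, then $g$. Monoidal structures are written as if strict, with unit $k$ and symmetry $c$. An additive symmetric monoidal category is a symmetric monoidal category enriched over commutative monoids (hom-sets have addition and zero, composition is bilinear) whose tensor functor is additive in both variables. In such a category finite coproducts are biproducts, written $\oplus$, with projections $\pi_1,\pi_2$ and pairing $\langle f,g\rangle$. A commutative algebra is a commutative monoid object; modules are left modules, with action $\bullet_M:A\otimes M\to M$. An algebra modality on a symmetric monoidal category consists of a monad $(T,\mu,\eta)$ and, for each object $C$, morphisms $m:TC\otimes TC\to TC$, $e:k\to TC$ making $TC$ a commutative algebra, such that $m,e$ are natural in $C$ (each $Tf$ is an algebra homomorphism) and each $\mu_C:T^2C\to TC$ is an algebra homomorphism. A codifferential category is an additive symmetric monoidal category with an algebra modality $T$ and a deriving transform, i.e. a transformation $d_{TC}:TC\to TC\otimes C$, natural in $C$, such that: (d1) $e;d=0$; (d2) $m;d=(1\otimes d);(m\otimes 1)+(d\otimes 1);c;(m\otimes 1)$, where $c$ here is the symmetry $TC\otimes C\otimes TC\to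 TC\otimes TC\otimes C$; (d3) $\eta;d=e\otimes 1$; (d4) $\mu_C;d_{TC}=d_{T^2C};(\mu_C\otimes d_{TC});(m\otimes 1_C)$. Each $T$-algebra $(A,\nu)$ has an associated commutative algebra structure with multiplication $(\eta_A\otimes\eta_A);m;\nu$ and unit $e;\nu$; an $A$-module is a module over it. For a $T$-algebra $(A,\nu)$ and an $A$-module $M$, $W(A,M)$ is the $T$-algebra $(A\oplus M,\beta)$ with $\beta=\langle\beta_1,\beta_2\rangle:T(A\oplus M)\to A\oplus M$, $\beta_1=T\pi_1;\nu$ and $\beta_2=d_{T(A\oplus M)};(T\pi_1\otimes\pi_2);(\nu\otimes 1_M);\bullet_M$. A $T$-derivation is a morphism $\partial:A\to M$ in $\mathcal{C}$ such that $\langle 1_A,\partial\rangle:A\to A\oplus M$ is a $T$-algebra homomorphism $A\to W(A,M)$. *)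

(* Defs.v *)
From mathcomp Require Import all_boot.

Set Implicit Arguments.
Unset Strict Implicit.
Unset Printing Implicit Defensive.

Declare Scope ob_scope.
Declare Scope hom_scope.
Delimit Scope ob_scope with ob.
Delimit Scope hom_scope with hom.

Reserved Notation "f ;; g" (at level 60, right associativity).
Reserved Notation "X ⊗ Y" (at level 40, left associativity).

(** Composition is in diagrammatic order. *)

Record category := Category {
  obj :> Type;
  hom : obj -> obj -> Type;
  idm : forall X, hom X X;
  comp : forall X Y Z, hom X Y -> hom Y Z -> hom X Z;
  comp1m : forall X Y (f : hom X Y), comp (idm X) f = f;
  compm1 : forall X Y (f : hom X Y), comp f (idm Y) = f;
  compA : forall X Y Z W (f : hom X Y) (g : hom Y Z) (h : hom Z W),
    comp f (comp g h) = comp (comp f g) h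
}.

Arguments hom {c} X%_ob Y%_ob : rename.
Arguments idm {c} X%_ob : rename.
Arguments comp {c X Y Z} f%_hom g%_hom : rename.
Bind Scope ob_scope with obj.
Bind Scope hom_scope with hom.
Open Scope hom_scope.

Notation "f ;; g" := (comp f g) : hom_scope.

Section Coequalizers.
Variable C : category.

Definition reflexive_pair (X Y : C) (f g : hom X Y) : Prop :=
  exists s : hom Y X, s ;; f = idm Y /\ s ;; g = idm Y.

Definition is_coequalizer (X Y Q : C) (f g : hom X Y) (q : hom Y Q) : Prop :=
  f ;; q = g ;; q /\
  forall (Z : C) (h : hom Y Z), f ;; h = g ;; h ->
    exists! u : hom Q Z, q ;; u = h.

Definition has_reflexive_coequalizers : Prop :=
  forall (X Y : C) (f g : hom X Y), reflexive_pair f g ->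
    exists (Q : C) (q : hom Y Q), is_coequalizer f g q.

End Coequalizers.

Record functor (C D : category) := Functor {
  fobj :> C -> D;
  fmap : forall X Y : C, hom X Y -> hom (fobj X) (fobj Y);
  fmap_id : forall X : C, fmap (idm X) = idm (fobj X);
  fmap_comp : forall (X Y Z : C) (f : hom X Y) (g : hom Y Z),
    fmap (f ;; g) = fmap f ;; fmap g
}.

Arguments fmap {C D} f {X Y} _%_hom : rename.

Record monad (C : category) := Monad {
  mfun :> functor C C;
  mu : forall X : C, hom (mfun (mfun X)) (mfun X);
  eta : forall X : C, hom X (mfun X);
  mu_nat : forall (X Y : C) (f : hom X Y),
    fmap mfun (fmap mfun f) ;; mu Y = mu X ;; fmap mfun f;
  eta_nat : forall (X Y : C) (f : hom X Y),
    f ;; eta Y = eta X ;; fmap mfun f;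
  mu_assoc : forall X : C, mu (mfun X) ;; mu X = fmap mfun (mu X) ;; mu X;
  eta_mu : forall X : C, eta (mfun X) ;; mu X = idm (mfun X);
  fmap_eta_mu : forall X : C, fmap mfun (eta X) ;; mu X = idm (mfun X)
}.

Arguments mu {C} m X%_ob : rename.
Arguments eta {C} m X%_ob : rename.

Record talgebra (C : category) (T : monad C) := TAlgebra {
  tcar :> C;
  tact : hom (T tcar) tcar;
  tact_eta : eta T tcar ;; tact = idm tcar;
  tact_mu : mu T tcar ;; tact = fmap T tact ;; tact
}.

Arguments tact {C T} A : rename.

Definition is_talgebra_hom (C : category) (T : monad C) (A B : talgebra T)
  (f : hom A B) : Prop := tact A ;; f = fmap T f ;; tact B.

Arguments is_talgebra_hom {C T} A B f%_hom.

(** Not assumed strict: associators and unitors are explicit here, and are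
    inserted wherever a formula is customarily written as if strict. *)

Record smcategory := SMCategory {
  smcat :> category;
  sunit : smcat;
  tens : smcat -> smcat -> smcat;
  tensm : forall X Y X' Y' : smcat,
    hom X X' -> hom Y Y' -> hom (tens X Y) (tens X' Y');
  tensm_id : forall X Y : smcat, tensm (idm X) (idm Y) = idm (tens X Y);
  tensm_comp : forall (X Y X' Y' X'' Y'' : smcat) (f : hom X X')
      (g : hom Y Y') (f' : hom X' X'') (g' : hom Y' Y''),
    tensm (f ;; f') (g ;; g') = tensm f g ;; tensm f' g';
  assoc : forall X Y Z : smcat,
    hom (tens (tens X Y) Z) (tens X (tens Y Z));
  associ : forall X Y Z : smcat,
    hom (tens X (tens Y Z)) (tens (tens X Y) Z);
  assocK : forall X Y Z : smcat, assoc X Y Z ;; associ X Y Z = idm _;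
  associK : forall X Y Z : smcat, associ X Y Z ;; assoc X Y Z = idm _;
  assoc_nat : forall (X Y Z X' Y' Z' : smcat) (f : hom X X') (g : hom Y Y')
      (h : hom Z Z'),
    tensm (tensm f g) h ;; assoc X' Y' Z' =
    assoc X Y Z ;; tensm f (tensm g h);
  lunit : forall X : smcat, hom (tens sunit X) X;
  luniti : forall X : smcat, hom X (tens sunit X);
  lunitK : forall X : smcat, lunit X ;; luniti X = idm _;
  lunitiK : forall X : smcat, luniti X ;; lunit X = idm _;
  lunit_nat : forall (X Y : smcat) (f : hom X Y),
    tensm (idm sunit) f ;; lunit Y = lunit X ;; f;
  runit : forall X : smcat, hom (tens X sunit) X;
  runiti : forall X : smcat, hom X (tens X sunit);
  runitK : forall X : smcat, runit X ;; runiti X = idm _;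
  runitiK : forall X : smcat, runiti X ;; runit X = idm _;
  runit_nat : forall (X Y : smcat) (f : hom X Y),
    tensm f (idm sunit) ;; runit Y = runit X ;; f;
  pentagon : forall W X Y Z : smcat,
    assoc (tens W X) Y Z ;; assoc W X (tens Y Z) =
    tensm (assoc W X Y) (idm Z) ;; assoc W (tens X Y) Z ;;
      tensm (idm W) (assoc X Y Z);
  triangle : forall X Y : smcat,
    assoc X sunit Y ;; tensm (idm X) (lunit Y) = tensm (runit X) (idm Y);
  symm : forall X Y : smcat, hom (tens X Y) (tens Y X);
  symm_nat : forall (X Y X' Y' : smcat) (f : hom X X') (g : hom Y Y'),
    tensm f g ;; symm X' Y' = symm X Y ;; tensm g f;
  symmK : forall X Y : smcat, symm X Y ;; symm Y X = idm _;
  hexagon : forall X Y Z : smcat,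
    assoc X Y Z ;; symm X (tens Y Z) ;; assoc Y Z X =
    tensm (symm X Y) (idm Z) ;; assoc Y X Z ;; tensm (idm Y) (symm X Z)
}.

Arguments sunit {s} : rename.
Arguments tens {s} X%_ob Y%_ob : rename.
Arguments tensm {s X Y X' Y'} f%_hom g%_hom : rename.
Arguments assoc {s} X%_ob Y%_ob Z%_ob : rename.
Arguments associ {s} X%_ob Y%_ob Z%_ob : rename.
Arguments lunit {s} X%_ob : rename.
Arguments luniti {s} X%_ob : rename.
Arguments runit {s} X%_ob : rename.
Arguments runiti {s} X%_ob : rename.
Arguments symm {s} X%_ob Y%_ob : rename.

Notation "X ⊗ Y" := (tens X Y) : ob_scope.
Notation "f ⊗ g" := (tensm f g) : hom_scope.

Section TensorLemmas.
Variable C : smcategory.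

Lemma tensm_compl (X X' X'' Y Y' : C) (f : hom X X') (f' : hom X' X'')
    (g : hom Y Y') : (f ;; f') ⊗ g = (f ⊗ g) ;; (f' ⊗ idm Y').
Proof. by rewrite -tensm_comp compm1. Qed.

Lemma tensm_compr (X X' Y Y' Y'' : C) (f : hom X X') (g : hom Y Y')
    (g' : hom Y' Y'') : f ⊗ (g ;; g') = (f ⊗ g) ;; (idm X' ⊗ g').
Proof. by rewrite -tensm_comp compm1. Qed.

Lemma tensmEr (X X' Y Y' : C) (f : hom X X') (g : hom Y Y') :
  f ⊗ g = (idm X ⊗ g) ;; (f ⊗ idm Y').
Proof. by rewrite -tensm_comp comp1m compm1. Qed.

Lemma tensmEl (X X' Y Y' : C) (f : hom X X') (g : hom Y Y') :
  f ⊗ g = (f ⊗ idm Y) ;; (idm X' ⊗ g).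
Proof. by rewrite -tensm_comp comp1m compm1. Qed.

Lemma associ_nat (X Y Z X' Y' Z' : C) (f : hom X X') (g : hom Y Y')
    (h : hom Z Z') :
  (f ⊗ (g ⊗ h)) ;; associ X' Y' Z' = associ X Y Z ;; ((f ⊗ g) ⊗ h).
Proof.
rewrite -[LHS]comp1m -(associK X Y Z) -!compA; congr (_ ;; _).
by rewrite [LHS]compA -assoc_nat -compA assocK compm1.
Qed.

Lemma luniti_nat (X Y : C) (f : hom X Y) :
  f ;; luniti Y = luniti X ;; (idm sunit ⊗ f).
Proof.
by rewrite -[RHS]compm1 -(lunitK Y) -compA (compA _ (lunit Y)) lunit_nat
  -compA (compA (luniti X)) lunitiK comp1m.
Qed.

End TensorLemmas.

Definition tensor_preserves_reflexive_coequalizers (C : smcategory) : Prop :=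
  forall (X Y Q : C) (f g : hom X Y) (q : hom Y Q),
    reflexive_pair f g -> is_coequalizer f g q ->
    forall Z : C,
      is_coequalizer (idm Z ⊗ f) (idm Z ⊗ g) (idm Z ⊗ q) /\
      is_coequalizer (f ⊗ idm Z) (g ⊗ idm Z) (q ⊗ idm Z).

Definition is_comm_algebra (C : smcategory) (A : C)
    (m : hom (A ⊗ A) A) (e : hom sunit A) : Prop :=
  [/\ (m ⊗ idm A) ;; m = assoc A A A ;; (idm A ⊗ m) ;; m,
      (e ⊗ idm A) ;; m = lunit A,
      (idm A ⊗ e) ;; m = runit A &
      symm A A ;; m = m].

Record comm_algebra (C : smcategory) := CommAlgebra {
  acar :> C;
  amul : hom (acar ⊗ acar) acar;
  aone : hom sunit acar;
  acommP : is_comm_algebra amul aone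
}.

Arguments amul {C} A : rename.
Arguments aone {C} A : rename.

Definition is_algebra_hom (C : smcategory) (A B : comm_algebra C)
    (f : hom A B) : Prop :=
  amul A ;; f = (f ⊗ f) ;; amul B /\ aone A ;; f = aone B.

Arguments is_algebra_hom {C} A B f%_hom.

Record module (C : smcategory) (A : comm_algebra C) := Module {
  mcar :> C;
  mact : hom (A ⊗ mcar) mcar;
  mact_mul : (amul A ⊗ idm mcar) ;; mact =
             assoc A A mcar ;; (idm A ⊗ mact) ;; mact;
  mact_one : (aone A ⊗ idm mcar) ;; mact = lunit mcar
}.

Arguments mact {C A} M : rename.

Definition is_linear (C : smcategory) (A : comm_algebra C) (M N : module A)
  (f : hom M N) : Prop := mact M ;; f = (idm A ⊗ f) ;; mact N.

Arguments is_linear {C A} M N f%_hom.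

Record algebra_modality (C : smcategory) := AlgebraModality {
  modmonad :> monad C;
  tmul : forall X : C, hom (modmonad X ⊗ modmonad X) (modmonad X);
  tone : forall X : C, hom sunit (modmonad X);
  talgP : forall X : C, is_comm_algebra (tmul X) (tone X);
  fmap_alg : forall (X Y : C) (f : hom X Y),
    is_algebra_hom (CommAlgebra (talgP X)) (CommAlgebra (talgP Y))
      (fmap modmonad f);
  mu_alg : forall X : C,
    is_algebra_hom (CommAlgebra (talgP (modmonad X))) (CommAlgebra (talgP X))
      (mu modmonad X)
}.

Arguments tmul {C} T X%_ob : rename.
Arguments tone {C} T X%_ob : rename.

Section AssociatedAlgebra.
Variables (C : smcategory) (T : algebra_modality C) (A : talgebra T).

Definition talg_mul : hom (A ⊗ A) A :=
  (eta T A ⊗ eta T A) ;; tmul T A ;; tact A.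

Definition talg_one : hom sunit A := tone T A ;; tact A.

Lemma tact_mul : (tact A ⊗ tact A) ;; talg_mul = tmul T A ;; tact A.
Proof.
have [mulT _] := fmap_alg T (tact A).
have [mulmu _] := mu_alg T A.
rewrite /= in mulT mulmu.
rewrite /talg_mul compA -tensm_comp !eta_nat tensm_comp -!compA.
rewrite (compA _ (tmul T A)) -mulT -compA -tact_mu (compA (tmul _ _)) mulmu.
by rewrite -!compA compA -tensm_comp eta_mu tensm_id comp1m.
Qed.

Lemma tact_tens (X Y : C) (f : hom X (T A)) (g : hom Y (T A)) :
  ((f ;; tact A) ⊗ (g ;; tact A)) ;; talg_mul =
  (f ⊗ g) ;; tmul T A ;; tact A.
Proof. by rewrite tensm_comp -compA tact_mul. Qed.

Lemma talg_commP : is_comm_algebra talg_mul talg_one.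
Proof.
have [mulA mul1 mulr1 mulC] := talgP T A.
have mulE : talg_mul = ((eta T A ⊗ eta T A) ;; tmul T A) ;; tact A.
  by rewrite -compA.
have one1 : idm A = eta T A ;; tact A by rewrite tact_eta.
split.
- rewrite {1}mulE {1}one1 tact_tens tensm_compl -!compA (compA (_ ⊗ idm (T A))).
  rewrite mulA {1}mulE {1}one1 tact_tens tensm_compr.
  by rewrite -!compA (compA (assoc A A A)) -assoc_nat -!compA.
- rewrite {1}one1 tact_tens tensmEr -compA (compA (tone T A ⊗ _)) mul1.
  by rewrite compA lunit_nat -compA tact_eta compm1.
- rewrite {1}one1 tact_tens tensmEl -compA (compA (_ ⊗ tone T A)) mulr1.
  by rewrite compA runit_nat -compA tact_eta compm1.
- by rewrite /talg_mul compA -symm_nat -!compA (compA _ _ (tact A)) mulC.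
Qed.

Definition talg_alg : comm_algebra C := CommAlgebra talg_commP.

End AssociatedAlgebra.

Arguments talg_alg {C T} A.

(** [Monoid.com_law zeroh] is a commutative monoid structure with neutral
    element [zeroh] on the bare type of morphisms; composition and tensor
    preserve both sums and zero in each variable. *)

Record additive_smcategory := AdditiveSMCategory {
  addsmcat :> smcategory;
  zeroh : forall X Y : addsmcat, hom X Y;
  addh : forall X Y : addsmcat, Monoid.com_law (zeroh X Y);
  comp0m : forall (X Y Z : addsmcat) (f : hom Y Z),
    zeroh X Y ;; f = zeroh X Z;
  compm0 : forall (X Y Z : addsmcat) (f : hom X Y),
    f ;; zeroh Y Z = zeroh X Z;
  compDm : forall (X Y Z : addsmcat) (f g : hom X Y) (h : hom Y Z),
    addh X Y f g ;; h = addh X Z (f ;; h) (g ;; h);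
  compmD : forall (X Y Z : addsmcat) (f : hom X Y) (g h : hom Y Z),
    f ;; addh Y Z g h = addh X Z (f ;; g) (f ;; h);
  tens0m : forall (X X' Y Y' : addsmcat) (f : hom Y Y'),
    zeroh X X' ⊗ f = zeroh _ _;
  tensm0 : forall (X X' Y Y' : addsmcat) (f : hom X X'),
    f ⊗ zeroh Y Y' = zeroh _ _;
  tensDm : forall (X X' Y Y' : addsmcat) (f g : hom X X') (h : hom Y Y'),
    addh X X' f g ⊗ h = addh _ _ (f ⊗ h) (g ⊗ h);
  tensmD : forall (X X' Y Y' : addsmcat) (f : hom X X') (g h : hom Y Y'),
    f ⊗ addh Y Y' g h = addh _ _ (f ⊗ g) (f ⊗ h)
}.

Arguments zeroh {a X Y} : rename.
Arguments addh {a X Y} : rename.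

Notation "0" := zeroh : hom_scope.
Notation "f + g" := (addh f g) : hom_scope.

(** In [der_mul] the symmetry is the one exchanging the last two factors of
    [TX ⊗ X ⊗ TX]. *)
Record deriving_transform (C : additive_smcategory) (T : algebra_modality C) :=
  DerivingTransform {
  der :> forall X : C, hom (T X) (T X ⊗ X);
  der_nat : forall (X Y : C) (f : hom X Y),
    fmap T f ;; der Y = der X ;; (fmap T f ⊗ f);
  der_one : forall X : C, tone T X ;; der X = 0;
  der_mul : forall X : C,
    tmul T X ;; der X =
      ((idm (T X) ⊗ der X) ;; associ (T X) (T X) X ;; (tmul T X ⊗ idm X)) +
      ((der X ⊗ idm (T X)) ;;
         (assoc (T X) X (T X) ;; (idm (T X) ⊗ symm X (T X)) ;;
          associ (T X) (T X) X) ;;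
         (tmul T X ⊗ idm X));
  der_eta : forall X : C,
    eta T X ;; der X = luniti X ;; (tone T X ⊗ idm X);
  der_mu : forall X : C,
    mu T X ;; der X =
      der (T X) ;; (mu T X ⊗ der X) ;; associ (T X) (T X) X ;;
        (tmul T X ⊗ idm X)
}.

Record codifferential_category := CodifferentialCategory {
  codcat :> additive_smcategory;
  codT : algebra_modality codcat;
  codd : deriving_transform codT
}.

(** Finite coproducts are given by chosen nullary and binary ones. *)
Record finite_coproducts (C : category) := FiniteCoproducts {
  initial : C;
  initialm : forall X : C, hom initial X;
  initialm_uniq : forall (X : C) (f : hom initial X), f = initialm X;
  coprod : C -> C -> C;
  inl_ : forall X Y : C, hom X (coprod X Y);
  inr_ : forall X Y : C, hom Y (coprod X Y);
  copair : forall X Y Z : C, hom X Z -> hom Y Z -> hom (coprod X Y) Z;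
  inl_copair : forall (X Y Z : C) (f : hom X Z) (g : hom Y Z),
    inl_ X Y ;; copair f g = f;
  inr_copair : forall (X Y Z : C) (f : hom X Z) (g : hom Y Z),
    inr_ X Y ;; copair f g = g;
  copair_uniq : forall (X Y Z : C) (h : hom (coprod X Y) Z),
    h = copair (inl_ X Y ;; h) (inr_ X Y ;; h)
}.

Arguments coprod {C} f X%_ob Y%_ob : rename.
Arguments inl_ {C} f X%_ob Y%_ob : rename.
Arguments inr_ {C} f X%_ob Y%_ob : rename.
Arguments copair {C} f {X Y Z} _%_hom _%_hom : rename.
Arguments copair_uniq {C} f {X Y Z} h%_hom : rename.

Section Biproducts.
Variables (C : additive_smcategory) (P : finite_coproducts C).

Definition bproj1 (X Y : C) : hom (coprod P X Y) X := copair P (idm X) 0.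
Definition bproj2 (X Y : C) : hom (coprod P X Y) Y := copair P 0 (idm Y).
Definition bpair (X Y Z : C) (f : hom Z X) (g : hom Z Y) :
  hom Z (coprod P X Y) := (f ;; inl_ P X Y) + (g ;; inr_ P X Y).

Lemma bpair_proj1 (X Y Z : C) (f : hom Z X) (g : hom Z Y) :
  bpair f g ;; bproj1 X Y = f.
Proof.
by rewrite compDm -!compA inl_copair inr_copair compm1 compm0 Monoid.mulm1.
Qed.

Lemma bpair_proj2 (X Y Z : C) (f : hom Z X) (g : hom Z Y) :
  bpair f g ;; bproj2 X Y = g.
Proof.
by rewrite compDm -!compA inl_copair inr_copair compm1 compm0 Monoid.mul1m.
Qed.

Lemma bproj_pair (X Y : C) : bpair (bproj1 X Y) (bproj2 X Y) = idm _.
Proof.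
rewrite [LHS](copair_uniq P) [RHS](copair_uniq P); congr (copair P _ _).
- by rewrite compmD !compA !inl_copair comp1m comp0m Monoid.mulm1 compm1.
- by rewrite compmD !compA !inr_copair comp1m comp0m Monoid.mul1m compm1.
Qed.

Lemma bpair_eta (X Y Z : C) (h : hom Z (coprod P X Y)) :
  bpair (h ;; bproj1 X Y) (h ;; bproj2 X Y) = h.
Proof. by rewrite /bpair -!compA -compmD [X in _ ;; X]bproj_pair compm1. Qed.

Lemma comp_bpair (X Y Z Z' : C) (h : hom Z' Z) (f : hom Z X) (g : hom Z Y) :
  h ;; bpair f g = bpair (h ;; f) (h ;; g).
Proof. by rewrite /bpair compmD !compA. Qed.

End Biproducts.

Arguments bproj1 {C} P X%_ob Y%_ob.
Arguments bproj2 {C} P X%_ob Y%_ob.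
Arguments bpair {C} P {X Y Z} f%_hom g%_hom.

Section Derivations.
Variables (C : codifferential_category) (P : finite_coproducts C).
Local Notation T := (codT C).
Local Notation d := (codd C).
Variables (A : talgebra T) (M : module (talg_alg A)).

Definition W_act1 : hom (T (coprod P A M)) A :=
  fmap T (bproj1 P A M) ;; tact A.

Definition W_act2 : hom (T (coprod P A M)) M :=
  d (coprod P A M) ;; (fmap T (bproj1 P A M) ⊗ bproj2 P A M) ;;
    (tact A ⊗ idm M) ;; mact M.

Definition W_act : hom (T (coprod P A M)) (coprod P A M) :=
  bpair P W_act1 W_act2.

Lemma W_act2E : W_act2 = d (coprod P A M) ;; (W_act1 ⊗ bproj2 P A M) ;; mact M.
Proof.
by rewrite /W_act2 (compA (_ ⊗ _) (_ ⊗ _)) -tensm_comp compm1.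
Qed.

Lemma W_act_eta : eta T (coprod P A M) ;; W_act = idm (coprod P A M).
Proof.
rewrite comp_bpair -[RHS]bproj_pair; congr (bpair P _ _).
  by rewrite compA -eta_nat -compA tact_eta compm1.
rewrite W_act2E (compA (eta _ _)) der_eta -compA.
have tone1 : tone T (coprod P A M) ;; W_act1 = aone (talg_alg A).
  have [_] := fmap_alg T (bproj1 P A M).
  by rewrite /W_act1 compA /= => ->.
rewrite (compA (_ ⊗ _) (_ ⊗ _)) -tensm_comp comp1m tone1 tensmEr -compA.
by rewrite mact_one compA -luniti_nat -compA lunitiK compm1.
Qed.

Lemma W_act_mu :
  mu T (coprod P A M) ;; W_act = fmap T W_act ;; W_act.
Proof.
have act1 : mu T (coprod P A M) ;; W_act1 = fmap T W_act ;; W_act1.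
  by rewrite /W_act1 compA -mu_nat -compA tact_mu compA -fmap_comp compA
    -fmap_comp bpair_proj1.
rewrite 2!comp_bpair act1; congr (bpair P _ _).
rewrite W_act2E !compA der_nat der_mu -!compA.
congr (_ ;; _).
have actM : (talg_mul A ⊗ idm M) ;; mact M =
  assoc A A M ;; (idm A ⊗ mact M) ;; mact M by exact: (mact_mul M).
have mulW : tmul T (coprod P A M) ;; W_act1 =
    (W_act1 ⊗ W_act1) ;; talg_mul A.
  have [mulP _] := fmap_alg T (bproj1 P A M).
  rewrite /= in mulP.
  by rewrite /W_act1 compA mulP tensm_comp -!compA tact_mul.
rewrite (compA (_ ⊗ idm _) (_ ⊗ _)) -tensm_comp mulW comp1m.
rewrite tensm_compl -compA actM (compA (_ ⊗ _) (assoc _ _ _)) assoc_nat.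
rewrite -(compA (assoc _ _ _)) (compA (associ _ _ _)) associK comp1m.
rewrite (compA (_ ⊗ _) (_ ⊗ _)) -tensm_comp act1.
rewrite (compA (_ ⊗ _) (_ ⊗ mact M)) -tensm_comp compm1 -(compA (d _)).
rewrite (compA (fmap T W_act ⊗ W_act)) -tensm_comp bpair_proj2 W_act2E.
by [].
Qed.

Definition W : talgebra T := TAlgebra W_act_eta W_act_mu.

Definition is_derivation (D : hom A M) : Prop :=
  is_talgebra_hom A W (bpair P (idm A) D).

End Derivations.

Arguments is_derivation {C} P {A} M D%_hom.

Definition is_universal_derivation (C : codifferential_category)
    (P : finite_coproducts C) (A : talgebra (codT C))
    (Omega : module (talg_alg A)) (dA : hom A Omega) : Prop :=
  is_derivation P Omega dA /\
  forall (M : module (talg_alg A)) (D : hom A M), is_derivation P M D ->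
    exists! u : hom Omega M, is_linear Omega M u /\ dA ;; u = D.

Arguments is_universal_derivation {C} P {A} Omega dA%_hom.

(* Main.v *)
From mathcomp Require Import all_boot.
Require Import Defs.

Set Implicit Arguments.
Unset Strict Implicit.
Unset Printing Implicit Defensive.

(** A map [D : A -> M] is a [T]-derivation iff [ν;D = d;(ν⊗D);•]. Writing a map
    [X -> M] as a linear map [A⊗X -> M] on the free module, this says that the
    linear extension of [D] coequalizes two linear maps from [A⊗TA] to [A⊗A],
    the extensions of [ν] followed by the unit of the free module and of
    [d;(ν⊗1)]. They have [1⊗η] as a common section, so their coequalizer
    exists, and it inherits a module structure because [⊗] preserves it. *)

Section Coherence.
Variable C : smcategory.

(** The left unitor is a natural isomorphism, so tensoring with the unit is faithful. *)
Lemma tens_sunit_inj (X Y : C) (f g : hom X Y) :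
  idm sunit ⊗ f = idm sunit ⊗ g -> f = g.
Proof.
move=> fg; rewrite -[f]comp1m -[g]comp1m -(lunitiK X) -!compA -!lunit_nat.
by rewrite fg.
Qed.

(* Kelly's argument: after tensoring with [k] on the left, this follows from
   the pentagon for [k, k, X, Y] and the triangle. *)
Lemma assoc_lunit (X Y : C) :
  assoc sunit X Y ;; lunit (X ⊗ Y)%ob = lunit X ⊗ idm Y.
Proof.
apply: tens_sunit_inj; rewrite tensm_compr.
have e : assoc sunit (sunit ⊗ X) Y ;;
    (idm sunit ⊗ assoc sunit X Y) ;; (idm sunit ⊗ lunit (X ⊗ Y)) =
    assoc sunit (sunit ⊗ X) Y ;; (idm sunit ⊗ (lunit X ⊗ idm Y)).
  have iso : (associ sunit sunit X ⊗ idm Y) ;; (assoc sunit sunit X ⊗ idm Y)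
      = idm _ by rewrite -tensm_comp associK compm1 tensm_id.
  rewrite -[LHS]comp1m -[RHS]comp1m -iso -!compA; congr (_ ;; _).
  have := congr1 (fun f => f ;; (idm sunit ⊗ lunit (X ⊗ Y)))
    (pentagon sunit sunit X Y).
  rewrite -!compA triangle => <-.
  by rewrite -assoc_nat compA -tensm_comp triangle compm1 -tensm_id assoc_nat.
by rewrite -[LHS]comp1m -[RHS]comp1m -(associK _ _ _) -!compA e.
Qed.

Lemma associ_lunit (X Y : C) :
  associ sunit X Y ;; (lunit X ⊗ idm Y) = lunit (X ⊗ Y)%ob.
Proof. by rewrite -assoc_lunit compA associK comp1m. Qed.

Lemma associ_runit (X Y : C) :
  associ X sunit Y ;; (runit X ⊗ idm Y) = idm X ⊗ lunit Y.
Proof. by rewrite -triangle compA associK comp1m. Qed.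

(** The pentagon with three of its associators moved across: the form in which associativity of
    [amul R] yields associativity of the free action. *)
Lemma associ_pentagon (W X Y Z : C) :
  assoc W X (Y ⊗ Z) ;; (idm W ⊗ associ X Y Z) ;; associ W (X ⊗ Y) Z =
  associ (W ⊗ X) Y Z ;; (assoc W X Y ⊗ idm Z).
Proof.
rewrite -[LHS]comp1m -(associK (W ⊗ X) Y Z) -compA; congr (_ ;; _).
rewrite compA pentagon -!compA (compA (_ ⊗ assoc _ _ _)) -tensm_comp.
by rewrite assocK compm1 tensm_id comp1m assocK compm1.
Qed.

End Coherence.

Section FreeModule.
Variables (C : smcategory) (R : comm_algebra C).

Definition free_act (X : C) : hom (R ⊗ (R ⊗ X)) (R ⊗ X) :=
  associ R R X ;; (amul R ⊗ idm X).

Lemma free_act_mul (X : C) :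
  (amul R ⊗ idm (R ⊗ X)) ;; free_act X =
  assoc R R (R ⊗ X) ;; (idm R ⊗ free_act X) ;; free_act X.
Proof.
have [mulA _ _ _] := acommP R.
rewrite /free_act tensm_compr -!compA (compA (_ ⊗ (_ ⊗ _))) associ_nat.
rewrite -!compA -tensm_comp comp1m.
rewrite (compA (_ ⊗ associ _ _ _)) (compA (assoc _ _ _)) associ_pentagon -compA.
rewrite -tensm_comp comp1m -mulA -tensm_id compA associ_nat -compA.
by rewrite -tensm_comp comp1m.
Qed.

Lemma free_act_one (X : C) :
  (aone R ⊗ idm (R ⊗ X)) ;; free_act X = lunit (R ⊗ X)%ob.
Proof.
have [_ mul1 _ _] := acommP R.
rewrite /free_act -tensm_id compA associ_nat -compA -tensm_comp mul1 comp1m.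
exact: associ_lunit.
Qed.

Definition free_module (X : C) : module R :=
  Module (free_act_mul X) (free_act_one X).

Definition free_unit (X : C) : hom X (free_module X) :=
  luniti X ;; (aone R ⊗ idm X).

(** The transpose of [D] under the free-forgetful adjunction: [a ⊗ x] goes to the action of [a] on
    [D x]. *)
Definition free_ext (X : C) (M : module R) (D : hom X M) :
  hom (free_module X) M := (idm R ⊗ D) ;; mact M.

Lemma free_ext_linear (X : C) (M : module R) (D : hom X M) :
  is_linear (free_module X) M (free_ext D).
Proof.
rewrite /is_linear /free_ext /= /free_act -compA (compA (_ ⊗ idm X)).
rewrite -tensm_comp compm1 comp1m tensmEr -compA mact_mul compA.
by rewrite tensm_compr !compA -tensm_id -associ_nat -!compA (compA (associ _ _ _))
  associK comp1m.
Qed.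

Lemma free_ext_comp (X : C) (M N : module R) (D : hom X M) (h : hom M N) :
  is_linear M N h -> free_ext D ;; h = free_ext (D ;; h).
Proof.
by move=> hlin; rewrite /free_ext -compA hlin compA -tensm_comp compm1.
Qed.

Lemma free_ext_precomp (X Y : C) (M : module R) (k : hom X Y) (D : hom Y M) :
  (idm R ⊗ k) ;; free_ext D = free_ext (k ;; D).
Proof. by rewrite /free_ext compA -tensm_comp compm1. Qed.

Lemma free_unit_ext (X : C) (M : module R) (D : hom X M) :
  free_unit X ;; free_ext D = D.
Proof.
rewrite /free_unit /free_ext -compA (compA (_ ⊗ _)) -tensm_comp compm1 comp1m.
by rewrite tensmEr -compA mact_one compA -luniti_nat -compA lunitiK compm1.
Qed.

(** The right unit law of [R]. With [free_ext_comp] it shows that a linear [h] on a free module is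
    the extension of [free_unit X ;; h]. *)
Lemma free_ext_unit (X : C) : free_ext (free_unit X) = idm (R ⊗ X).
Proof.
have [_ _ mulr1 _] := acommP R.
rewrite /free_ext /free_unit /= /free_act tensm_compr -compA.
rewrite (compA (_ ⊗ (_ ⊗ _))) associ_nat -compA -tensm_comp mulr1 comp1m.
by rewrite associ_runit -tensm_comp lunitiK compm1 tensm_id.
Qed.

Lemma free_linear_inj (X : C) (M : module R) (h k : hom (free_module X) M) :
  is_linear (free_module X) M h -> is_linear (free_module X) M k ->
  free_unit X ;; h = free_unit X ;; k -> h = k.
Proof.
move=> hlin klin hk.
by rewrite -[h]comp1m -[k]comp1m -free_ext_unit !free_ext_comp // hk.
Qed.

End FreeModule.

Lemma coequalizer_epi (C : category) (X Y Q : C) (f g : hom X Y) (q : hom Y Q) :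
  is_coequalizer f g q ->
  forall (Z : C) (h k : hom Q Z), q ;; h = q ;; k -> h = k.
Proof.
move=> [fgq univ] Z h k hk.
have [|u [_ uniq]] := univ Z (q ;; k); first by rewrite !compA fgq.
by rewrite -(uniq h) // -(uniq k).
Qed.

(** Since [R ⊗ -] preserves the underlying coequalizer [q], linearity of [f] and [g] makes
    [mact N ;; q] descend to an action on [Q]. *)
Lemma module_coequalizer (C : smcategory) (R : comm_algebra C)
    (M N : module R) (f g : hom M N) :
  has_reflexive_coequalizers C -> tensor_preserves_reflexive_coequalizers C ->
  reflexive_pair f g -> is_linear M N f -> is_linear M N g ->
  exists (K : module R) (q : hom N K),
    [/\ is_linear N K q, f ;; q = g ;; q &
        forall (L : module R) (h : hom N L), is_linear N L h ->
          f ;; h = g ;; h -> exists! u : hom K L, is_linear K L u /\ q ;; u = h].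
Proof.
move=> hcoeq hpres rfg flin glin; have [Q [q qcoeq]] := hcoeq _ _ f g rfg.
have tcoeq Z := (hpres _ _ _ _ _ _ rfg qcoeq Z).1.
(* A tensored [q] is again a coequalizer, hence epi; the module laws and the linearity of the
   induced map are checked after precomposing with it. *)
have tepi Z := coequalizer_epi (tcoeq Z).
have [fgq univ] := qcoeq.
have [|a [qa _]] := (tcoeq R).2 _ (mact N ;; q).
  by rewrite !compA -flin -glin -!compA fgq.
have a_mul : (amul R ⊗ idm Q) ;; a = assoc R R Q ;; (idm R ⊗ a) ;; a.
  apply: (tepi (R ⊗ R)%ob); rewrite compA -tensmEr tensmEl -compA qa.
  rewrite compA mact_mul -tensm_id [RHS]compA assoc_nat -!compA.
  congr (_ ;; _).
  by rewrite [RHS]compA -tensm_comp qa comp1m tensm_compr -compA qa.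
have a_one : (aone R ⊗ idm Q) ;; a = lunit Q.
  by apply: (tepi sunit); rewrite compA -tensmEr tensmEl -compA qa compA
    mact_one lunit_nat.
exists (Module a_mul a_one), q; split=> [||L h hlin fgh] //.
have [u [qu uniq]] := univ L h fgh.
exists u; split=> [|v [_ /uniq //]]; split=> //.
rewrite /is_linear /=; apply: (tepi R).
by rewrite compA qa -compA qu hlin compA -tensm_comp qu compm1.
Qed.

(** The first component of the homomorphism condition holds for every [D], as [D'] followed by the
    first projection is the identity. By naturality of [d], the second component is the stated
    equation. *)
Lemma is_derivationE (C : codifferential_category) (P : finite_coproducts C)
    (A : talgebra (codT C)) (M : module (talg_alg A)) (D : hom A M) :
  is_derivation P M D <->
  tact A ;; D = codd C A ;; (tact A ⊗ D) ;; mact M.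
Proof.
set D' := bpair P (idm A) D.
have act1 : fmap (codT C) D' ;; W_act1 P M = tact A.
  by rewrite /W_act1 compA -fmap_comp bpair_proj1 fmap_id comp1m.
have act2 : fmap (codT C) D' ;; W_act2 P M =
    codd C A ;; (tact A ⊗ D) ;; mact M.
  rewrite W_act2E compA der_nat -compA (compA (_ ⊗ _)) -tensm_comp.
  by rewrite act1 bpair_proj2.
rewrite /is_derivation /is_talgebra_hom /= /W_act !comp_bpair compm1 act1 act2.
split=> [e|-> //].
by rewrite -(bpair_proj2 P (tact A) (tact A ;; D)) e bpair_proj2.
Qed.

Theorem theorem4p23 (C : codifferential_category) (P : finite_coproducts C)
    (hcoeq : has_reflexive_coequalizers C)
    (hpres : tensor_preserves_reflexive_coequalizers C)
    (A : talgebra (codT C)) :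
  exists (Omega : module (talg_alg A)) (dA : hom A Omega),
    is_universal_derivation P Omega dA.
Proof.
pose R := talg_alg A; pose u := free_unit R A.
pose k : hom (codT C A) (free_module R A) :=
  codd C A ;; (tact A ⊗ idm A).
pose f := free_ext (tact A ;; u : hom _ (free_module R A)).
pose g := free_ext k.
have kE (M : module R) (D : hom A M) :
    k ;; free_ext D = codd C A ;; (tact A ⊗ D) ;; mact M.
  by rewrite /k /free_ext -compA (compA (_ ⊗ _) (_ ⊗ _)) -tensm_comp compm1
    comp1m.
have etak : eta (codT C) A ;; k = u.
  by rewrite /k compA der_eta -compA -tensm_comp comp1m.
(* For [f] the section law comes from the unit law of the [T]-algebra, for [g] from axiom (d3)
   through [etak]. *)
have rfg : reflexive_pair f g.
  exists (idm R ⊗ eta (codT C) A); rewrite !free_ext_precomp etak.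
  by rewrite compA tact_eta comp1m free_ext_unit.
(* A linear map on a free module is determined along the unit, so the coequalizing condition reduces
   to [tact A ;; u ;; h = k ;; h]. As [h] extends [u ;; h], this is the derivation equation. *)
have coeqE (M : module R) (h : hom (free_module R A) M) :
    is_linear (free_module R A) M h ->
    f ;; h = g ;; h <-> is_derivation P M (u ;; h).
  move=> hlin.
  have hE : h = free_ext (u ;; h).
    by rewrite -free_ext_comp // free_ext_unit comp1m.
  have [derE Eder] := @is_derivationE C P A M (u ;; h).
  rewrite -kE -hE in derE Eder; rewrite /f /g !free_ext_comp // -compA.
  split=> [e|/derE -> //]; apply: Eder.
  by rewrite -[LHS](free_unit_ext (R := R)) e free_unit_ext.
have [Omega [q [qlin fgq univ]]] := module_coequalizer hcoeq hpres rfg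
  (free_ext_linear _) (free_ext_linear _).
exists Omega, (u ;; q); split=> [|M D Dder]; first exact/coeqE.
have Dlin := free_ext_linear D.
have [|v [[vlin qv] uniq]] := univ M (free_ext D) Dlin.
  by apply/coeqE; rewrite ?free_unit_ext.
exists v; split=> [|w [wlin qw]].
  by split=> //; rewrite -compA qv free_unit_ext.
(* Both [q ;; w] and [free_ext D] are linear on the free module and restrict to [D] along [u], so
   they agree. *)
apply: uniq; split=> //.
apply: free_linear_inj => //; last by rewrite free_unit_ext compA.
by rewrite /is_linear compA qlin -compA wlin compA -tensm_comp compm1.
Qed.
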